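(* Let $q=p^r$ with $p$ prime, $m\ge2$, $a,b\in\mathbb F_q$ with $a\ne0$, $b\ne0$, and let $t$ be a positive divisor of $m$ with $p\nmid\frac mt$. Let $\gamma_t$ be a primitive element of $\mathbb F_{q^t}$, $g=\operatorname{N}_{\mathbb F_{q^t}/\mathbb F_q}(\gamma_t)$, $d=\gcd(q-1,\frac mt)$, and assume $d\mid\operatorname{ind}_g b$. Let $i_0$ be a solution of $\frac{m}{dt}\,i\equiv\frac{\operatorname{ind}_g b}{d}\pmod{\frac{q-1}{d}}$ and $a_0=\frac tm a$. For $i=0,\dots,d-1$ put $c_i=g^{\frac{q-1}{d}i+i_0}a_0^{-t}$ and let $N(c_i)$ be the number of solutions $(x_1,\dots,x_t)\in\mathbb F_q^t$ of the system $x_1+\cdots+x_t=1$, $x_1\cdots x_t=c_i$. Then \[ N_t(a,b)=\frac{d(q^t-1)}{q(q-1)}+(-1)^{t-1}\Bigl(\sum_{i=0}^{d-1}N(c_i)-\frac{d(q-1)^t}{q(q-1)}\Bigr). \]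
   Context: For a positive divisor $t$ of $m$, regard $\mathbb F_{q^t}\subseteq\mathbb F_{q^m}$ and let $N_t(a,b)$ be the number of $x\in\mathbb F_{q^t}^*$ with $\operatorname{Tr}_{\mathbb F_{q^m}/\mathbb F_q}(x)=a$ and $\operatorname{N}_{\mathbb F_{q^m}/\mathbb F_q}(x)=b$. $\operatorname{ind}_g b$ is the discrete logarithm of $b$ to base $g$. *)

(* Defs.v *)
From HB Require Import structures.
From mathcomp Require Import all_boot all_order all_algebra all_fingroup all_field.

Set Implicit Arguments.
Unset Strict Implicit.
Unset Printing Implicit Defensive.

Import GRing.Theory.
Local Open Scope ring_scope.

Section ElementCounts.

(* [finvect_type E] is [E] itself with its canonical finType and
   splittingFieldType structures, so that its elements can be counted and
   [galTrace] and [galNorm] apply without further hypotheses on [E]. *)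
Variables (F : finFieldType) (E : fieldExtType F).
Local Notation L := (finvect_type E).

Definition primitive_element (K : {subfield L}) (gamma : L) : Prop :=
  [/\ gamma \in K, gamma != 0
    & forall x : L, x \in K -> x != 0 -> exists k : nat, x = gamma ^+ k].

(* Trace and norm are those of the top field L over F, even for x in K. *)
Definition card_trace_norm (K : {subfield L}) (a b : F) : nat :=
  #|[set x : L | [&& x \in K, x != 0,
                     galTrace 1%AS {:L}%AS x == a%:A
                   & galNorm 1%AS {:L}%AS x == b%:A]]|.

End ElementCounts.

Section BaseField.

Variable F : finFieldType.

(* The least k < #|F| - 1 with g ^+ k = b; the junk value #|F| - 1 occurs only
   if there is none, e.g. if b = 0. *)
Definition discrete_log (g b : F) : nat :=
  index b [seq g ^+ k | k <- iota 0 #|F|.-1].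

Definition card_sum_prod (t : nat) (c : F) : nat :=
  #|[set x : {ffun 'I_t -> F} | (\sum_i x i == 1) && (\prod_i x i == c)]|.

End BaseField.

(* Main.v *)
(** Work in the group algebra of F x F^* and attach to a monic polynomial f over
F with f(0) <> 0 the group element [f] = (sum of the roots, product of the
roots), which is multiplicative in f.  The zeta function
Z(T) = sum_f [f] T^(deg f) equals 1 + G T + S T^2 / (1 - q T), where
G = sum_(x <> 0) [X - x] and S is the sum of all group elements, because the
top two and the bottom coefficients equidistribute in degree at least 2.  By the
Euler product, the coefficient of T^n in T Z' / Z is the sum over irreducible P
with deg P * j = n of deg P [P]^j, i.e. the sum of (Tr y, N y) over y in
F_(q^n)^*.  Comparing the two expressions for T Z' / Z on the ideal generated by
S (where Z = (1 - T) / (1 - q T)) and on its complement (where Z = 1 + G T)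
expresses the trace-norm counts through G^n, i.e. through the number of
solutions of x_1 + ... + x_n = u, x_1 ... x_n = v.  Group algebra elements are
represented by the linear forms they define on functions phi : F -> F -> rat with
phi u 0 = 0; [conv] is multiplication by G and [mass] is the form S.

The theorem is this identity for F_(q^t), since for x in F_(q^t) the trace and
norm from F_(q^m) are the multiple m / t and the power m / t of those from
F_(q^t), and the equation v^(m/t) = b has the d solutions g^((q-1)/d i + i_0). *)
Require Import Defs.
From HB Require Import structures.
From mathcomp Require Import all_boot all_order all_algebra all_fingroup all_field.
From mathcomp Require Import qpoly zify ring.

Set Implicit Arguments.
Unset Strict Implicit.
Unset Printing Implicit Defensive.

Import Order.TTheory GRing.Theory Num.Theory.
Local Open Scope ring_scope.

(** * Sum and product of the roots of a monic polynomial, read off its coefficients *)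

Section TraceNormPoly.
Variable R : idomainType.
Implicit Types f g : {poly R}.

(** The factor ['X] shifts the index by one, so that the constant polynomial 1 gets trace 0;
    truncated subtraction in the index would pick its constant term instead. *)
Definition poly_tr f : R := - ('X * f)`_(size f).-1.
Definition poly_nm f : R := (-1) ^+ (size f).-1 * f`_0.

Lemma size_monicM f g : f \is monic -> g \is monic ->
  (size (f * g)).-1 = ((size f).-1 + (size g).-1)%N.
Proof.
move=> fm gm; rewrite size_monicM ?monic_neq0 //.
have := monic_neq0 fm; have := monic_neq0 gm.
by rewrite -!size_poly_gt0; lia.
Qed.

Lemma monic_decomp f : f \is monic ->
  exists2 r : {poly R}, f = 'X^((size f).-1) + r & (size r <= (size f).-1)%N.
Proof.
move=> fm; exists (f - 'X^((size f).-1)); first by rewrite addrC subrK.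
apply/leq_sizeP => j hj; rewrite coefB coefXn.
have [->|hn] := eqVneq; first by rewrite -lead_coefE (monicP fm) subrr.
rewrite subr0 nth_default // (leq_trans (leqSpred _)) //.
by rewrite ltn_neqAle eq_sym hn.
Qed.

Lemma poly_trM f g : f \is monic -> g \is monic ->
  poly_tr (f * g) = poly_tr f + poly_tr g.
Proof.
move=> fm gm; rewrite /poly_tr size_monicM //.
have [r fE sr] := monic_decomp fm; have [s gE ss] := monic_decomp gm.
move: (size f).-1 (size g).-1 => m n in fE gE sr ss *.
rewrite {}fE {}gE.
(* At index [m + n] the first two summands give the two traces up to sign; ['X^((m + n).+1)] has too
   large a degree and ['X * (r * s)] too small a degree to contribute. *)
have -> : 'X * (('X^m + r) * ('X^n + s)) =
  'X^m * ('X * s) + 'X^n * ('X * r) + ('X^((m + n).+1) + 'X * (r * s)) :> {poly R}.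
  by rewrite exprS exprD; ring.
rewrite !mulrDr -!exprS !coefD !coefXnM !coefXn.
rewrite [X in _ + (_ + X)]nth_default; last first.
  have [->|r0] := eqVneq r 0; first by rewrite mul0r mulr0 size_poly0.
  have [->|s0] := eqVneq s 0; first by rewrite !mulr0 size_poly0.
  rewrite mulrC size_mulX ?mulf_neq0 // size_mul //.
  by move: r0 s0; rewrite -!size_poly_gt0; lia.
do ![case: ifP => ?; try lia].
rewrite addKn addnK.
have -> : ((m + n)%N == (m + n).+1) = false by lia.
have -> : (m == m.+1) = false by lia.
have -> : (n == n.+1) = false by lia.
by rewrite /=; ring.
Qed.

Lemma poly_nmM f g : f \is monic -> g \is monic ->
  poly_nm (f * g) = poly_nm f * poly_nm g.
Proof. by move=> fm gm; rewrite /poly_nm size_monicM // coef0M exprD; ring. Qed.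

Lemma poly_tr1 : poly_tr 1 = 0.
Proof. by rewrite /poly_tr size_poly1 mulr1 coefX oppr0. Qed.

Lemma poly_nm1 : poly_nm 1 = 1.
Proof. by rewrite /poly_nm size_poly1 coef1 mulr1. Qed.

Lemma poly_trX f n : f \is monic -> poly_tr (f ^+ n) = poly_tr f *+ n.
Proof.
move=> fm; elim: n => [|n IH]; first by rewrite poly_tr1.
by rewrite exprS poly_trM ?monic_exp // IH mulrS.
Qed.

Lemma poly_nmX f n : f \is monic -> poly_nm (f ^+ n) = poly_nm f ^+ n.
Proof.
move=> fm; elim: n => [|n IH]; first by rewrite poly_nm1.
by rewrite exprS poly_nmM ?monic_exp // IH exprS.
Qed.

Lemma poly_tr_XsubC c : poly_tr ('X - c%:P) = c.
Proof. by rewrite /poly_tr size_XsubC coefXM /= coefB coefX coefC /= sub0r opprK. Qed.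

Lemma poly_nm_XsubC c : poly_nm ('X - c%:P) = c.
Proof. by rewrite /poly_nm size_XsubC coefB coefX coefC /= expr1 sub0r mulN1r opprK. Qed.

Lemma poly_tr_prod_XsubC (I : Type) (s : seq I) (P : pred I) (c : I -> R) :
  poly_tr (\prod_(i <- s | P i) ('X - (c i)%:P)) = \sum_(i <- s | P i) c i.
Proof.
elim: s => [|i s IH]; first by rewrite !big_nil poly_tr1.
rewrite !big_cons; case: (P i) => //.
by rewrite poly_trM ?monicXsubC ?monic_prod_XsubC // poly_tr_XsubC IH.
Qed.

Lemma poly_nm_prod_XsubC (I : Type) (s : seq I) (P : pred I) (c : I -> R) :
  poly_nm (\prod_(i <- s | P i) ('X - (c i)%:P)) = \prod_(i <- s | P i) c i.
Proof.
elim: s => [|i s IH]; first by rewrite !big_nil poly_nm1.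
rewrite !big_cons; case: (P i) => //.
by rewrite poly_nmM ?monicXsubC ?monic_prod_XsubC // poly_nm_XsubC IH.
Qed.

Lemma poly_tr_mulXD f c : f \is monic -> (1 < size f)%N ->
  poly_tr (f * 'X + c%:P) = poly_tr f.
Proof.
move=> fm sf; rewrite /poly_tr size_MXaddC (negPf (monic_neq0 fm)) /=.
have -> : size f = (size f).-1.+1 by lia.
rewrite /= !coefXM /= coefD coefMX coefC.
by case: (size f) sf => [|[|k]] //= _; rewrite addr0.
Qed.

Lemma poly_nm_mulXD f c : f \is monic ->
  poly_nm (f * 'X + c%:P) = (-1) ^+ size f * c.
Proof.
move=> fm; rewrite /poly_nm size_MXaddC (negPf (monic_neq0 fm)) /=.
by rewrite coefD coefMX coefC /= add0r.
Qed.

End TraceNormPoly.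

Lemma poly_tr_map (R S : fieldType) (h : {rmorphism R -> S}) (f : {poly R}) :
  poly_tr (map_poly h f) = h (poly_tr f).
Proof.
by rewrite /poly_tr size_map_poly -(map_polyX h) -rmorphM coef_map rmorphN.
Qed.

Lemma poly_nm_map (R S : fieldType) (h : {rmorphism R -> S}) (f : {poly R}) :
  poly_nm (map_poly h f) = h (poly_nm f).
Proof. by rewrite /poly_nm size_map_poly coef_map rmorphM rmorphXn rmorphN1. Qed.

(** * Enumeration of monic and of irreducible polynomials, and factorization *)

Lemma exists_irreducible_divisor (R : finFieldType) (f : {poly R}) :
  (1 < size f)%N ->
  exists Q : {poly R}, [/\ Q \is monic, irreducible_poly Q & Q %| f].
Proof.
elim: {f}_.+1 {-2}f (ltnSn (size f)) => // n IH f sf sf1.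
have f0 : f != 0 by rewrite -size_poly_gt0; lia.
case: (irreducibleP f) => [fi|].
  exists ((lead_coef f)^-1 *: f).
  have lf : (lead_coef f)^-1 != 0 by rewrite invr_eq0 lead_coef_eq0.
  split; first by rewrite monicE lead_coefZ mulVf // lead_coef_eq0.
    split; first by rewrite size_scale //; case: fi.
    move=> q q1; rewrite dvdpZr // => qf.
    by rewrite (eqp_trans (fi.2 q q1 qf)) // eqp_sym eqp_scale.
  by rewrite dvdpZl.
(* The boolean test ranges over divisors of size below that of [f], so its failure yields a smaller
   nonconstant divisor to recurse on. *)
move=> /irreducibleP; rewrite /irreducibleb sf1 /= negb_forall => /existsP[q].
rewrite negb_imply -ltnNge -Pdiv.Idomain.dvdpE => /andP[qf sq].
have [||Q [Qm Qi Qq]] := IH (q : {poly_((size f).-1) R}) => //.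
  apply: leq_ltn_trans (size_npoly (q : {poly_((size f).-1) R})) _.
  by rewrite -ltnS prednK // ltnW.
by exists Q; split => //; apply: dvdp_trans qf.
Qed.

Lemma dvdp_exp_leq (R : idomainType) (P f : {poly R}) j :
  P ^+ j %| f -> f != 0 -> (1 < size P)%N -> (j <= (size f).-1)%N.
Proof.
move=> Pf f0 sP; have := dvdp_leq f0 Pf; have := size_exp P j.
have : (0 < size (P ^+ j))%N.
  by rewrite size_poly_gt0 expf_neq0 // -size_poly_gt0; lia.
nia.
Qed.

Section Monics.
Variable F : finFieldType.
Implicit Types P Q f : {poly F}.

Definition irreds N : seq {poly F} :=
  [seq P <- [seq (val p : {poly F}) | p : {poly_N.+1 F}]
     | (P \is monic) && irreducibleb P].

Lemma mem_irreds N P :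
  P \in irreds N <-> [/\ P \is monic, irreducible_poly P & ((size P).-1 <= N)%N].
Proof.
rewrite mem_filter; split.
  case/andP => /andP[Pm /irreducibleP Pi] /mapP[p _ PE]; split=> //.
  by have := size_npoly p; rewrite PE; case: (size _).
case=> Pm /irreducibleP Pi sP; rewrite Pm Pi /=.
have sP' : (size P <= N.+1)%N by rewrite (leq_trans (leqSpred _)).
by apply/mapP; exists (NPoly sP'); rewrite ?mem_enum.
Qed.

Lemma irreds_uniq N : uniq (irreds N).
Proof. by rewrite filter_uniq // map_inj_uniq ?enum_uniq //; apply: val_inj. Qed.

Lemma dvdp_irred_eq P Q : P \is monic -> Q \is monic ->
  irreducible_poly P -> irreducible_poly Q -> P %| Q -> P = Q.
Proof.
move=> Pm Qm Pi Qi PQ; apply/eqP; rewrite -eqp_monic //.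
by apply: Qi.2 => //; have := Pi.1; lia.
Qed.

(** For fixed [P] the inner sum is the multiplicity of [P] in [f], so this is additivity of the
    degree over the factorization. The induction removes one irreducible factor [Q], which lowers
    the multiplicity of [Q] by one and leaves the others unchanged. *)
Lemma sum_irreds_dvd N n f : f \is monic -> (size f).-1 = n -> (n <= N)%N ->
  (\sum_(P <- irreds N) (size P).-1 * \sum_(1 <= j < N.+1) (P ^+ j %| f)%R = n)%N.
Proof.
elim: n {-2}n (leqnn n) f => [|n0 IH] n nn f fm sf nN.
  have n0 : n = 0%N by lia.
  rewrite n0 in sf *.
  rewrite big1_seq // => P /andP[_ /mem_irreds[Pm Pi _]].
  rewrite big1_seq ?muln0 // => j /andP[_]; rewrite mem_index_iota => hj.
  apply/eqP; rewrite eqb0; apply/negP => /dvdp_exp_leq.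
  by rewrite monic_neq0 // sf => /(_ isT Pi.1); case: j hj.
have [nE|n_gt0] := posnP n.
  by apply: IH => //; rewrite nE.
have [Q [Qm Qi Qf]] : exists Q, [/\ Q \is monic, irreducible_poly Q & Q %| f].
  by apply: exists_irreducible_divisor; rewrite -sf in n_gt0; case: (size f) n_gt0 => [|[]].
have [g fE] : exists g, f = Q * g.
  by case/dvdpP: Qf => g ->; exists g; rewrite mulrC.
have gm : g \is monic by move: fm; rewrite fE monicMl.
have sfg := size_monicM Qm gm; rewrite -fE sf in sfg.
have sQ := Qi.1.
have sQ' : (0 < (size Q).-1)%N by case: (size Q) sQ => [|[]].
have [QleN leg ltg] :
    [/\ ((size Q).-1 <= N)%N, ((size g).-1 <= n0)%N & ((size g).-1 < N)%N].
  by move: sQ' nn nN; rewrite sfg; move: (size Q).-1 (size g).-1 => x y; split; lia.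
have QN : Q \in irreds N by apply/mem_irreds.
have IHg := IH (size g).-1 leg g gm erefl (ltnW ltg).
rewrite (bigD1_seq Q) ?irreds_uniq //=.
move: IHg; rewrite (bigD1_seq Q) ?irreds_uniq //=.
(* Shifting [j] by one turns divisibility of [Q * g] into divisibility of [g]. The leftover index
   [j = N] contributes nothing because [g] has degree below [N]. *)
have -> : (\sum_(1 <= j < N.+1) (Q ^+ j %| f)%R = 1 + \sum_(1 <= j < N.+1) (Q ^+ j %| g)%R)%N.
  rewrite big_nat_recl //=; last by lia.
  rewrite expr1 Qf [in RHS]big_nat_recr //=; last by lia.
  have -> : (Q ^+ N %| g)%R = false.
    apply/negP => /dvdp_exp_leq; rewrite monic_neq0 // => /(_ isT sQ).
    by rewrite leqNgt ltg.
  rewrite addn0; congr addn; apply: eq_bigr => j _.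
  by rewrite exprS fE dvdp_mul2l ?monic_neq0.
rewrite mulnDr muln1 -addnA => IHg.
rewrite [X in (_ + (_ + X))%N](_ : _ = \sum_(i <- irreds N | i != Q)
      (size i).-1 * \sum_(1 <= j < N.+1) (i ^+ j %| g)%R)%N.
  by rewrite IHg.
rewrite big_seq_cond [RHS]big_seq_cond; apply: eq_bigr => P /andP[/mem_irreds[Pm Pi _] PQ].
congr muln; apply: eq_bigr => j _; rewrite fE Gauss_dvdpr //.
rewrite coprimep_expl // irreducible_poly_coprime //.
by apply: contraNN PQ => /dvdp_irred_eq ->.
Qed.

(** Horner recursion: the constant coefficient [c] is a free parameter at each step, which is what
    the equidistribution arguments use. *)
Fixpoint monics n : seq {poly F} :=
  if n is n'.+1 then [seq h * 'X + c%:P | h <- monics n', c <- enum F]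
  else [:: 1].

Lemma mem_monics n f : (f \in monics n) = (f \is monic) && ((size f).-1 == n).
Proof.
elim: n f => [|n IH] f /=.
  rewrite inE; apply/eqP/andP => [->|[fm /eqP sf]].
    by rewrite monic1 size_poly1.
  have sf1 : (size f <= 1)%N by case: (size f) sf => [|[]].
  have fE := size1_polyC sf1; rewrite fE; congr polyC.
  by rewrite -(monicP fm) lead_coefE sf.
apply/allpairsP/andP => [[[h c] /= [hn _ ->]]|[fm /eqP sf]].
  move: hn; rewrite IH => /andP[hm /eqP hs].
  have sh : size h = n.+1.
    by move: (monic_neq0 hm); rewrite -size_poly_gt0 -hs; case: (size h).
  rewrite size_MXaddC (negPf (monic_neq0 hm)) /= sh eqxx; split=> //.
  apply/monicP; rewrite lead_coefE size_MXaddC (negPf (monic_neq0 hm)) /=.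
  by rewrite coefD coefMX coefC sh /= addr0 -(monicP hm) lead_coefE sh.
elim/poly_ind: f fm sf => [|h c _] fm sf; first by rewrite size_poly0 in sf.
exists (h, c) => /=; rewrite mem_enum IH; split=> //.
have sh : size h = n.+1.
  by move: sf; rewrite size_MXaddC; case: ifP.
rewrite sh eqxx andbT; apply/monicP; rewrite -(monicP fm) !lead_coefE.
rewrite size_MXaddC -size_poly_eq0 sh /=.
by rewrite coefD coefMX coefC /= addr0.
Qed.

Lemma monics_uniq n : uniq (monics n).
Proof.
elim: n => [|n IH] //=; apply: allpairs_uniq; rewrite ?enum_uniq //.
move=> [h c] [h' c'] _ _ /= E.
have cE : c = c' by have := congr1 (coefp 0) E; rewrite /= !coefD !coefMX !coefC /= !add0r.
congr (_, _) => //; apply/polyP => i.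
by have := congr1 (coefp i.+1) E; rewrite /= !coefD !coefMX !coefC /= !addr0.
Qed.

Lemma size_monics n f : f \in monics n -> size f = n.+1.
Proof.
rewrite mem_monics => /andP[/monic_neq0 f0 /eqP <-].
by rewrite prednK ?size_poly_gt0.
Qed.

Lemma big_monicsM n (G : {poly F} -> rat) Q : Q \is monic -> ((size Q).-1 <= n)%N ->
  \sum_(f <- monics n | Q %| f) G f = \sum_(h <- monics (n - (size Q).-1)) G (Q * h).
Proof.
move=> Qm sQ; rewrite -big_filter -[RHS](big_map (fun h => Q * h) xpredT).
apply: perm_big; apply: uniq_perm.
- by rewrite filter_uniq ?monics_uniq.
- by rewrite map_inj_uniq ?monics_uniq //; apply/mulfI/monic_neq0.
move=> f; rewrite mem_filter mem_monics.
apply/idP/mapP => [/and3P[/dvdpP[h ->] fm /eqP sf]|[h]].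
  exists h; rewrite 1?mulrC // mem_monics.
  have hm : h \is monic by move: fm; rewrite monicMr.
  by rewrite -sf (size_monicM hm Qm) addnK eqxx hm.
rewrite mem_monics => /andP[hm sh] ->.
by rewrite dvdp_mulr // monicMl // hm (size_monicM Qm hm) (eqP sh) subnKC /=.
Qed.

End Monics.

(** * The zeta function and its logarithmic derivative, evaluated on functions of trace and norm *)

Section WeightedCounting.
Variables (F : finFieldType) (N : nat).
Implicit Types (phi psi : F -> F -> rat) (P h : {poly F}).

Definition conv phi (u v : F) : rat := \sum_c phi (u + c) (v * c).
Definition mass phi : rat := \sum_u \sum_v phi u v.

(** The coefficient of [T^n] in Z acting on [phi]; it is again a function of [(u, v)], so that such
    coefficients can be composed. Polynomials with zero constant term are included and drop out when
    [phi u 0 = 0]. *)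
Definition monic_sum n phi (u v : F) : rat :=
  \sum_(h <- monics F n) phi (u + poly_tr h) (v * poly_nm h).

(** The coefficient of [T^k] in [T Z' / Z], with the von Mangoldt weight deg P on each power of [P].
    The bound [N] only makes the ranges finite: no term is lost when [k <= N]. *)
Definition mangoldt_sum k phi : rat :=
  \sum_(P <- irreds F N) \sum_(1 <= j < N.+1 | (size (P ^+ j)).-1 == k)
    (size P).-1%:R * phi (poly_tr (P ^+ j)) (poly_nm (P ^+ j)).

Lemma mangoldt_sum_ext k phi psi : phi =2 psi ->
  mangoldt_sum k phi = mangoldt_sum k psi.
Proof.
by move=> E; apply: eq_bigr => P _; apply: eq_bigr => j _; rewrite E.
Qed.

Lemma mangoldt_sumZ k (a : rat) phi :
  mangoldt_sum k (fun u v => a * phi u v) = a * mangoldt_sum k phi.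
Proof.
rewrite mulr_sumr; apply: eq_bigr => P _; rewrite mulr_sumr.
by apply: eq_bigr => j _; rewrite mulrCA.
Qed.

Lemma mangoldt_sum0 phi : mangoldt_sum 0 phi = 0.
Proof.
rewrite /mangoldt_sum big_seq big1 // => P /mem_irreds[Pm Pi _].
rewrite big_nat_cond big1 // => j /andP[/andP[j0 _]].
by rewrite size_exp; have := Pi.1; case: (size P) => [|[|n]] //=; case: j j0.
Qed.

(* The logarithmic derivative T Z' = (T Z' / Z) Z, read off at T^n. *)
Lemma monic_sum_rec n phi : (n <= N)%N ->
  n%:R * monic_sum n phi 0 1 =
  \sum_(0 <= k < n.+1) mangoldt_sum k (monic_sum (n - k) phi).
Proof.
move=> nN; pose w f := phi (poly_tr f) (poly_nm f).
(* The factor [n] is written as the sum of deg P over the powers [P ^+ j] dividing [f]; after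
   exchanging sums, [f] runs over the multiples [P ^+ j * h] of degree [n]. *)
transitivity (\sum_(P <- irreds F N) \sum_(1 <= j < N.+1)
   if ((size (P ^+ j)%R).-1 <= n)%N then
     (size P).-1%:R * \sum_(h <- monics F (n - (size (P ^+ j)%R).-1)) w (P ^+ j * h)
   else 0).
  transitivity (\sum_(f <- monics F n) \sum_(P <- irreds F N)
     \sum_(1 <= j < N.+1) (size P).-1%:R * ((P ^+ j %| f)%R%:R * w f)).
    rewrite mulr_sumr big_seq [RHS]big_seq; apply: eq_bigr => f.
    rewrite mem_monics => /andP[fm /eqP sf].
    rewrite add0r mul1r -/(w f) -(sum_irreds_dvd fm sf nN).
    rewrite natr_sum mulr_suml; apply: eq_bigr => P _.
    rewrite natrM natr_sum -mulrA mulr_suml mulr_sumr.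
    by apply: eq_bigr.
  rewrite exchange_big big_seq [RHS]big_seq; apply: eq_bigr => P /mem_irreds[Pm Pi _].
  rewrite exchange_big; apply: eq_bigr => j _ /=.
  have Pjm : P ^+ j \is monic by rewrite monic_exp.
  rewrite -mulr_sumr.
  rewrite (_ : \sum_(f <- _) _ = \sum_(f <- monics F n | P ^+ j %| f) w f); last first.
    rewrite [RHS]big_mkcond; apply: eq_bigr => f _.
    by case: ifP; rewrite ?mul1r ?mul0r.
  case: ifP => [le|]; first by rewrite big_monicsM.
  move/negbT; rewrite -ltnNge => lt; rewrite big_seq_cond big1 ?mulr0 // => f.
  rewrite mem_monics => /andP[/andP[fm /eqP sf] /dvdp_leq].
  rewrite monic_neq0 // => /(_ isT) le; move: lt.
  by rewrite ltnNge -sf => /negP[]; rewrite -!subn1 leq_sub2r.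
rewrite /mangoldt_sum [RHS]exchange_big big_seq [RHS]big_seq.
apply: eq_bigr => P /mem_irreds[Pm Pi _].
under [RHS]eq_bigr do rewrite big_mkcond.
rewrite [RHS]exchange_big; apply: eq_bigr => j _ /=.
rewrite -[RHS]big_mkcond (eq_bigl (fun k => k == (size (P ^+ j)).-1)); last first.
  by move=> k; rewrite eq_sym.
rewrite big_nat1_eq ltnS /=; case: ifP => // le.
congr (_ * _); rewrite big_seq [RHS]big_seq; apply: eq_bigr => h.
rewrite mem_monics => /andP[hm _].
by rewrite /w poly_trM ?monic_exp // poly_nmM // monic_exp.
Qed.

Let q : rat := #|F|%:R.

Lemma big_monicsS n (G : {poly F} -> rat) :
  \sum_(f <- monics F n.+1) G f = \sum_(h <- monics F n) \sum_c G (h * 'X + c%:P).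
Proof. by rewrite big_allpairs_dep; apply: eq_bigr => h _; rewrite big_enum. Qed.

Lemma monic_sum0 phi u v : monic_sum 0 phi u v = phi u v.
Proof. by rewrite /monic_sum /= big_seq1 poly_tr1 poly_nm1 addr0 mulr1. Qed.

Lemma monic_sum1 phi u v : monic_sum 1 phi u v = conv phi u v.
Proof.
rewrite /monic_sum big_monicsS big_seq1.
rewrite (reindex_inj oppr_inj); apply: eq_bigr => c _.
have -> : 1 * 'X + (- c)%:P = 'X - c%:P :> {poly F} by rewrite mul1r polyCN.
by rewrite poly_tr_XsubC poly_nm_XsubC.
Qed.

(** From degree 2 on, the constant coefficient does not affect the trace, so each further degree
    contributes a factor [q]. *)
Lemma sum_monics_tr n (B : F -> rat) :
  \sum_(h <- monics F n.+1) B (poly_tr h) = q ^+ n * \sum_u B u.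
Proof.
elim: n => [|n IH].
  rewrite mul1r.
  have -> : \sum_(h <- monics F 1) B (poly_tr h) = monic_sum 1 (fun u _ => B u) 0 1.
    by apply: eq_bigr => h _; rewrite add0r.
  by rewrite monic_sum1; apply: eq_bigr => c _; rewrite add0r.
rewrite big_monicsS.
transitivity (\sum_(h <- monics F n.+1) q * B (poly_tr h)).
  rewrite big_seq [RHS]big_seq; apply: eq_bigr => h hn.
  have := hn; rewrite mem_monics => /andP[hm _].
  rewrite (eq_bigr (fun=> B (poly_tr h))) => [|c _]; last first.
    by rewrite poly_tr_mulXD // (size_monics hn).
  by rewrite sumr_const -mulr_natl.
by rewrite -mulr_sumr IH mulrA -exprS.
Qed.

(** In [h * 'X + c%:P] the trace depends on [h] alone and the norm is [c] up to sign, so the two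
    vary independently. Since [v] is nonzero, [v] times the norm still runs once over [F]. *)
Lemma monic_sum_ge2 n phi u v : v != 0 ->
  monic_sum n.+2 phi u v = q ^+ n * mass phi.
Proof.
move=> v0; rewrite /monic_sum big_monicsS.
transitivity (\sum_(h <- monics F n.+1) \sum_w phi (u + poly_tr h) w).
  rewrite big_seq [RHS]big_seq; apply: eq_bigr => h hn.
  have := hn; rewrite mem_monics => /andP[hm _].
  have e0 : v * (-1) ^+ size h != 0 by rewrite mulf_neq0 // expf_neq0 // oppr_eq0 oner_eq0.
  rewrite [RHS](reindex_inj (mulfI e0)).
  apply: eq_bigr => c _.
  by rewrite poly_tr_mulXD // ?(size_monics hn) // poly_nm_mulXD // (size_monics hn) mulrA.
rewrite (sum_monics_tr n (fun x => \sum_w phi (u + x) w)) /mass.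
by rewrite [\sum_u0 \sum_v0 phi u0 v0](reindex_inj (addrI u)).
Qed.

Lemma card_neq0 : q != 0.
Proof. by rewrite pnatr_eq0 -lt0n (ltn_trans _ (finNzRing_gt1 F)). Qed.

Lemma card_neq1 : q - 1 != 0.
Proof. by rewrite subr_eq0 pnatr_eq1 neq_ltn finNzRing_gt1 orbT. Qed.

Lemma sum_indicator_neq0 : \sum_(c : F) (c != 0)%:R = q - 1 :> rat.
Proof.
have -> : \sum_(c : F) (c != 0)%:R = #|predC1 (0 : F)|%:R :> rat.
  rewrite -sum1_card natr_sum [RHS]big_mkcond; apply: eq_bigr => c _.
  by rewrite inE; case: ifP.
by rewrite cardC1 -subn1 natrB // ltnW // finNzRing_gt1.
Qed.

(** The augmentation of the group algebra, extended by 0. For [phi] vanishing at [v = 0], every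
    [monic_sum] of degree at least 2 is a multiple of it. *)
Definition nz_indicator (u v : F) : rat := (v != 0)%:R.

Lemma mass_nz_indicator : mass nz_indicator = q * (q - 1).
Proof.
rewrite /mass (eq_bigr (fun=> q - 1)) => [|u _]; last exact: sum_indicator_neq0.
by rewrite sumr_const -mulr_natl.
Qed.

Lemma conv_ext phi psi : phi =2 psi -> conv phi =2 conv psi.
Proof. by move=> E u v; apply: eq_bigr => c _; rewrite E. Qed.

Lemma iter_conv_nz_indicator n u v :
  iter n conv nz_indicator u v = (q - 1) ^+ n * nz_indicator u v.
Proof.
elim: n u v => [|n IH] u v; first by rewrite mul1r.
rewrite iterS (conv_ext IH) /conv -mulr_sumr exprSr -mulrA; congr (_ * _).
rewrite -sum_indicator_neq0 mulr_suml; apply: eq_bigr => c _.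
by rewrite /nz_indicator mulf_eq0 negb_or mulrC -natrM mulnb.
Qed.

(** Each nonzero [c] acts by a bijection of the pairs and preserves the mass; [c = 0] contributes
    nothing. *)
Lemma mass_conv phi : (forall u, phi u 0 = 0) -> mass (conv phi) = (q - 1) * mass phi.
Proof.
move=> phi0; rewrite -sum_indicator_neq0 mulr_suml /mass.
rewrite (eq_bigr (fun u => \sum_c \sum_v phi (u + c) (v * c))); last first.
  by move=> u _; rewrite exchange_big.
rewrite exchange_big; apply: eq_bigr => c _ /=.
rewrite [RHS]mulr_sumr [RHS](reindex_inj (addIr c)); apply: eq_bigr => u _.
have [->|c0] := eqVneq c 0.
  by rewrite mul0r big1 // => v _; rewrite mulr0 phi0.
by rewrite mul1r [RHS](reindex_inj (mulIf c0)).
Qed.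

Lemma conv_vanish phi : (forall u, phi u 0 = 0) -> forall u, conv phi u 0 = 0.
Proof. by move=> phi0 u; rewrite /conv big1 // => c _; rewrite mul0r. Qed.

(** The summand pairs the coefficient [q ^+ (n - k)] of S in degree [n - k + 2] of Z with the value
    [q ^+ k - 1] of [T Z' / Z] in degree [k] on the augmentation. *)
Lemma sum_geometric_weights n :
  (q - 1) * \sum_(1 <= k < n.+1) q ^+ (n - k) * (q ^+ k - 1) =
  n%:R * q ^+ n * (q - 1) - (q ^+ n - 1).
Proof.
elim: n => [|n IH]; first by rewrite big_geq // expr0; ring.
rewrite big_nat_recr //= subnn mul1r.
have -> : \sum_(1 <= k < n.+1) q ^+ (n.+1 - k) * (q ^+ k - 1) =
          q * \sum_(1 <= k < n.+1) q ^+ (n - k) * (q ^+ k - 1).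
  rewrite mulr_sumr !big_nat; apply: eq_bigr => k /andP[_ kn].
  by rewrite subSn // exprS mulrA.
rewrite mulrDr mulrCA IH -(natr1 n) exprS; ring.
Qed.

(* Z = 1 + conv T + S T^2 / (1 - q T) with S the total mass, S conv = (q - 1) S
   and S^2 = q (q - 1) S, so Z equals (1 - T) / (1 - q T) on the component of S
   and 1 + conv T on its complement. *)
Theorem mangoldt_sum_formula n phi : (0 < n <= N)%N -> (forall u, phi u 0 = 0) ->
  mangoldt_sum n phi =
  (q ^+ n - 1) / (q * (q - 1)) * mass phi
  + (-1) ^+ n.-1 * (iter n conv phi 0 1
                    - (q - 1) ^+ n / (q * (q - 1)) * mass phi).
Proof.
have q0 := card_neq0; have q1 := card_neq1.
elim/ltn_ind: n phi => -[|[|n]] // IH phi /andP[_ nN] phi0.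
  have := monic_sum_rec phi nN.
  rewrite monic_sum1 mul1r !big_nat_recl // big_geq // mangoldt_sum0 add0r addr0.
  rewrite (mangoldt_sum_ext _ (monic_sum0 phi)) => <-.
  by rewrite /=; field; apply/andP.
have := monic_sum_rec phi nN.
(* The two top terms of the recursion carry the coefficients 1 and G of Z: the first is the unknown,
   the second is the induction hypothesis for [conv phi]. All lower terms carry multiples of S. *)
rewrite monic_sum_ge2 ?oner_neq0 // big_nat_recr // subnn.
rewrite (mangoldt_sum_ext _ (monic_sum0 phi)) big_nat_recr //.
rewrite subSnn (mangoldt_sum_ext _ (monic_sum1 phi)).
rewrite (IH n.+1 (ltnSn _) (conv phi) (ltnW nN) (conv_vanish phi0)) -iterSr mass_conv //.
set I := iter n.+2 conv phi 0 1.
rewrite big_nat_recl //= mangoldt_sum0 add0r.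
have -> : \sum_(0 <= k < n) mangoldt_sum k.+1 (monic_sum (n.+2 - k.+1) phi) =
  \sum_(1 <= k < n.+1) q ^+ (n - k) * (q ^+ k - 1) * mass phi.
  rewrite big_add1 /= !big_nat; apply: eq_bigr => k /andP[_ kn].
  (* On [nz_indicator] the bracket in the induction hypothesis cancels, leaving [q ^+ k.+1 - 1]. *)
  rewrite (@mangoldt_sum_ext _ _ (fun u v => q ^+ (n - k.+1) * mass phi * nz_indicator u v)).
    rewrite mangoldt_sumZ IH; first last.
    - by move=> u; rewrite /nz_indicator eqxx.
    - by rewrite /=; lia.
    - by lia.
    rewrite iter_conv_nz_indicator mass_nz_indicator /nz_indicator oner_neq0.
    by rewrite /=; field; apply/andP.
  move=> u v; have [->|v0] := eqVneq v 0.
    rewrite /nz_indicator eqxx mulr0 /monic_sum big1 // => h _.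
    by rewrite mul0r phi0.
  have -> : (n.+2 - k.+1 = (n - k.+1).+2)%N by lia.
  by rewrite monic_sum_ge2 // /nz_indicator v0 mulr1.
rewrite -mulr_suml.
have := sum_geometric_weights n.
move: (\sum_(1 <= k < n.+1) _) => G GE.
have {GE} -> : G = n%:R * q ^+ n - (q ^+ n - 1) / (q - 1).
  by apply: (mulfI q1); rewrite GE; field.
rewrite -(natr1 n.+1) -(natr1 n) !exprS => E.
rewrite (canRL (addKr _) (esym E)); field; exact/andP.
Qed.

End WeightedCounting.

(** * Characteristic polynomials of elements as powers of minimal polynomials *)

Lemma monic_eq_exp (F : finFieldType) (P Q : {poly F}) : P \is monic ->
  Q \is monic ->
  (forall R : {poly F}, R \is monic -> irreducible_poly R -> R %| Q -> R = P) ->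
  exists j, Q = P ^+ j.
Proof.
move=> Pm; elim: {Q}_.+1 {-2}Q (ltnSn (size Q)) => // n IH Q sQ Qm QP.
have [sQ1|sQ1] := leqP (size Q) 1.
  exists 0; rewrite expr0 (size1_polyC sQ1); congr polyC.
  rewrite -(monicP Qm) lead_coefE; case: (size Q) sQ1 => [|[]] //.
have [R [Rm Ri RQ]] := exists_irreducible_divisor sQ1.
have RP := QP R Rm Ri RQ; move: Ri RQ; rewrite {}RP => Pi PQ.
have [Q' QE] := dvdpP _ _ PQ.
have Q'm : Q' \is monic by move: Qm; rewrite QE monicMr.
have [j Q'E] : exists j, Q' = P ^+ j.
  apply: IH => // [|R' R'm R'i R'Q]; last by apply: QP => //; rewrite QE dvdp_mulr.
  apply: leq_trans (_ : size Q <= n)%N => //.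
  rewrite QE size_mul ?monic_neq0 //.
  have := Pi.1; have : (0 < size Q')%N by rewrite size_poly_gt0 monic_neq0.
  by move: (size P) (size Q') => x y; lia.
by exists j.+1; rewrite QE Q'E exprSr.
Qed.

Section GaloisPoly.
Variables (F : finFieldType) (L : splittingFieldType F) (K : {subfield L}).
Local Notation toL := (map_poly (GRing.in_alg L)).

Lemma exists_minPoly_base (y : L) : exists P : {poly F},
  [/\ P \is monic, irreducible_poly P, root (toL P) y
    & forall R : {poly F}, root (toL R) y -> P %| R].
Proof.
have [P PE] := polyOver1P (minPolyOver 1 y).
have PR (R : {poly F}) : root (toL R) y -> P %| R.
  move=> Ry; rewrite -(dvdp_map (GRing.in_alg L)) -PE minPoly_dvdp //.
  by apply/polyOver1P; exists R.
have Py : root (toL P) y by rewrite -PE root_minPoly.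
have Pm : P \is monic by rewrite -(map_monic (GRing.in_alg L)) -PE monic_minPoly.
exists P; split=> //; split.
  by rewrite -(size_map_poly (GRing.in_alg L)) -PE size_minPoly ltnS.
move=> R R1 RP; have := @minPoly_irr _ _ 1%AS y (toL R).
rewrite PE dvdp_map eqp_map -(rmorph1 (map_poly (GRing.in_alg L))) eqp_map.
case/(_ _ RP)/orP => //; first by apply/polyOver1P; exists R.
by rewrite -size_poly_eq1 (negPf R1).
Qed.

(** For [y] in [K], the characteristic polynomial of [y] over [F]: conjugates occur with
    multiplicity, so its trace and norm are those of the extension [K] over [F]. *)
Definition gal_poly (y : L) : {poly L} := \prod_(s in 'Gal(K / 1)%g) ('X - (s y)%:P).

Lemma gal_poly_over1 y : y \in K -> gal_poly y \is a polyOver 1%VS.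
Proof.
move=> Ky; have gK : galois 1 K by apply/finField_galois/sub1v.
rewrite -(galois_fixedField gK); apply/polyOverP => i; apply/fixedFieldP.
  apply/polyOverP: i; apply: rpred_prod => s _.
  by rewrite polyOverXsubC memv_gal.
move=> s sG; rewrite -coef_map rmorph_prod; congr (_ : {poly _})`_i.
rewrite [RHS](reindex_inj (mulIg s)); apply: eq_big => [u|u _].
  by rewrite groupMr.
by rewrite rmorphB /= map_polyX map_polyC /= galM.
Qed.

Lemma size_gal_poly y : size (gal_poly y) = (\dim K).+1.
Proof.
have gK : galois 1 K by apply/finField_galois/sub1v.
rewrite /gal_poly -big_enum size_prod_XsubC -cardE -(galois_dim gK).
by rewrite dimv1 divn1.
Qed.

Lemma gal_poly_irred_pow (y : L) : y \in K -> exists (P : {poly F}) (j : nat),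
  [/\ P \is monic, irreducible_poly P, root (toL P) y,
      forall R : {poly F}, root (toL R) y -> P %| R
    & gal_poly y = toL (P ^+ j)].
Proof.
move=> Ky; have [P [Pm Pi Py PR]] := exists_minPoly_base y.
have [Q QE] := polyOver1P (gal_poly_over1 Ky).
have Qm : Q \is monic.
  by rewrite -(map_monic (GRing.in_alg L)) -QE monic_prod_XsubC.
have [|j QP] := @monic_eq_exp _ P Q Pm Qm; last first.
  by exists P, j; split; rewrite // QE QP.
move=> R Rm Ri RQ; apply/esym/dvdp_irred_eq => //; apply: PR.
move: RQ; rewrite -(dvdp_map (GRing.in_alg L)) -QE /gal_poly -big_enum.
case/dvdp_prod_XsubC => m Em.
have smE : exists2 s : gal_of K, s \in 'Gal(K / 1)%g & root (toL R) (s y).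
  case mE: (mask m (enum 'Gal(K / 1)%g)) => [|s r].
    move: Em; rewrite mE big_nil -size_poly_eq1 size_map_poly => /eqP sR.
    by have := Ri.1; rewrite sR.
  exists s; first by rewrite -mem_enum (@mem_mask _ _ m) // mE mem_head.
  by rewrite (eqp_root Em) mE big_cons rootM root_XsubC eqxx.
(* [R] has coefficients in [F], hence is fixed by [s], so its root [s y] can be pulled back to the
   root [y]. *)
case: smE => s sG; rewrite -{1}[toL R](fixedPoly_gal (sub1v K) sG).
  by rewrite fmorph_root.
by apply/polyOver1P; exists R.
Qed.

Lemma gal_poly_tr y : poly_tr (gal_poly y) = galTrace 1 K y.
Proof. exact: poly_tr_prod_XsubC. Qed.

Lemma gal_poly_nm y : poly_nm (gal_poly y) = galNorm 1 K y.
Proof. exact: poly_nm_prod_XsubC. Qed.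

End GaloisPoly.

(** * Passing from irreducible polynomials to elements of the subfield *)

Section FieldCount.
Variables (F : finFieldType) (E : fieldExtType F).
Local Notation L := (finvect_type E).
Variable K : {subfield L}.
Local Notation toL := (map_poly (GRing.in_alg L)).
Implicit Types (phi : F -> F -> rat) (P : {poly F}).

(* Inverse of the embedding of F, with junk value 0 outside its image. *)
Definition to_base (z : L) : F := odflt 0 [pick u : F | z == u%:A].

Lemma to_baseK (u : F) : to_base u%:A = u.
Proof.
rewrite /to_base; case: pickP => [v /eqP uv|/(_ u)]; last by rewrite eqxx.
by rewrite (fmorph_inj (GRing.in_alg L) uv).
Qed.

Local Notation tr y := (to_base (galTrace 1 K y)).
Local Notation nm y := (to_base (galNorm 1 K y)).
Local Notation t := (\dim K).

Definition nroots P : nat := #|[set y : L | [&& y \in K, y != 0 & root (toL P) y]]|.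

Lemma nroots_le P : P \is monic -> (nroots P <= (size P).-1)%N.
Proof.
move=> Pm; have P0 : toL P != 0 by rewrite map_poly_eq0 monic_neq0.
rewrite /nroots cardE -(size_map_poly (GRing.in_alg L)).
have := @max_poly_roots _ (toL P) (enum [set y : L | [&& y \in K, y != 0 & root (toL P) y]]) P0.
rewrite enum_uniq => /(_ _ isT) lt.
rewrite -ltnS (leq_trans (lt _)) ?leqSpred //.
by apply/allP => y; rewrite mem_enum inE => /and3P[].
Qed.

Lemma dim_subfield_gt0 : (0 < t)%N.
Proof. exact: adim_gt0. Qed.

(** Elements are grouped by their minimal polynomial [P]. The characteristic polynomial is [P ^+ j]
    with [j] fixed by the degree [t], and it determines trace and norm. *)
Lemma sum_gal_nroots phi :
  \sum_(y : L | (y \in K) && (y != 0)) phi (tr y) (nm y) =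
  \sum_(P <- irreds F t) \sum_(1 <= j < t.+1 | (size (P ^+ j)).-1 == t)
    (nroots P)%:R * phi (poly_tr (P ^+ j)) (poly_nm (P ^+ j)).
Proof.
transitivity (\sum_(y : L | (y \in K) && (y != 0))
  \sum_(P <- irreds F t) \sum_(1 <= j < t.+1 | (size (P ^+ j)).-1 == t)
    (root (toL P) y)%:R * phi (poly_tr (P ^+ j)) (poly_nm (P ^+ j))).
  apply: eq_bigr => y /andP[Ky y0].
  have [P [j [Pm Pi Py PR yP]]] := gal_poly_irred_pow Ky.
  have sj : ((size P).-1 * j)%N = t.
    by rewrite -size_exp -(size_map_poly (GRing.in_alg L)) -yP size_gal_poly.
  have j0 : (0 < j)%N.
    by have := dim_subfield_gt0; rewrite -sj muln_gt0 => /andP[].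
  have P1 : (0 < (size P).-1)%N by case: (size P) Pi.1 => [|[]].
  have Pin : P \in irreds F t by apply/mem_irreds; split; rewrite // -sj leq_pmulr.
  rewrite (bigD1_seq P) ?irreds_uniq //= [X in _ + X]big_seq_cond.
  rewrite [X in _ + X]big1 => [|R /andP[/mem_irreds[Rm Ri _] RP]]; last first.
    rewrite big1 // => i _; case Ry: (root (toL R) y); last by rewrite mul0r.
    by rewrite (dvdp_irred_eq Pm Rm Pi Ri (PR R Ry)) eqxx in RP.
  rewrite addr0 (eq_bigl (fun i => i == j)); last first.
    by move=> i; rewrite size_exp -sj eqn_pmul2l.
  rewrite big_nat1_eq ltnS j0 -{1}sj leq_pmull //= Py mul1r.
  by rewrite -gal_poly_tr -gal_poly_nm yP poly_tr_map poly_nm_map /= !to_baseK.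
rewrite exchange_big; apply: eq_bigr => P _.
rewrite exchange_big; apply: eq_bigr => j _ /=.
rewrite -mulr_suml -natr_sum; congr (_%:R * _).
rewrite /nroots -sum1_card big_mkcond [RHS]big_mkcond.
by apply: eq_bigr => y _; rewrite inE; case: (y \in K) => //=; case: (y != 0) => //=; case: root.
Qed.

Lemma sum_gal_nz_indicator :
  \sum_(y : L | (y \in K) && (y != 0)) nz_indicator (tr y) (nm y) = #|F|%:R ^+ t - 1.
Proof.
transitivity (\sum_(y : L | (y \in K) && (y != 0)) 1 : rat).
  apply: eq_bigr => y /andP[Ky y0]; rewrite /nz_indicator.
  suff -> : nm y != 0 by [].
  have [P [j [_ _ _ _ yP]]] := gal_poly_irred_pow Ky.
  rewrite -gal_poly_nm yP poly_nm_map /= to_baseK.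
  apply: contraNneq y0 => nm0; rewrite -(galNorm_eq0 1 K) -gal_poly_nm yP.
  by rewrite poly_nm_map nm0 rmorph0.
rewrite -natrX -card_vspace (cardD1 0) mem0v add1n -natr1 addrK.
rewrite -sum1_card natr_sum; apply: eq_bigl => y.
by rewrite !inE andbC.
Qed.

(* Every y in K* is a root of exactly one P in the sum and P has at most deg P
   roots; the total over K* being q ^ t - 1 forces equality for each P <> X. *)
Lemma sum_gal_mangoldt phi : (forall u, phi u 0 = 0) ->
  \sum_(y : L | (y \in K) && (y != 0)) phi (tr y) (nm y) = mangoldt_sum t t phi.
Proof.
move=> phi0; have q0 := card_neq0 F; have q1 := card_neq1 F.
pose D P j (psi : F -> F -> rat) :=
  ((size P).-1%:R - (nroots P)%:R) * psi (poly_tr (P ^+ j)) (poly_nm (P ^+ j)).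
have subE psi : mangoldt_sum t t psi -
   \sum_(y : L | (y \in K) && (y != 0)) psi (tr y) (nm y) =
   \sum_(P <- irreds F t) \sum_(1 <= j < t.+1 | (size (P ^+ j)).-1 == t) D P j psi.
  rewrite sum_gal_nroots -sumrB; apply: eq_bigr => P _.
  by rewrite -sumrB; apply: eq_bigr => j _; rewrite -mulrBl.
apply/esym/eqP; rewrite -subr_eq0 subE; apply/eqP.
(* For the augmentation both totals are [q ^ t - 1], so the nonnegative defects [D] sum to zero and
   each of them vanishes. *)
have := subE (@nz_indicator F).
rewrite sum_gal_nz_indicator mangoldt_sum_formula; first last.
- by move=> u; rewrite /nz_indicator eqxx.
- by rewrite dim_subfield_gt0 leqnn.
rewrite iter_conv_nz_indicator mass_nz_indicator /nz_indicator oner_neq0.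
rewrite [X in X = _](_ : _ = 0); last by rewrite /=; field; apply/andP.
have D_ge0 P j : P \in irreds F t -> 0 <= D P j (@nz_indicator F).
  case/mem_irreds => Pm _ _.
  by rewrite mulr_ge0 ?ler0n // subr_ge0 ler_nat nroots_le.
rewrite big_seq => /esym/eqP; rewrite psumr_eq0; last first.
  by move=> P Pin; apply: sumr_ge0 => j _; apply: D_ge0.
move/allP => D0; rewrite big_seq big1 // => P Pin.
have := D0 P Pin; rewrite Pin /= psumr_eq0 => [/allP {}D0|j _]; last exact: D_ge0.
rewrite big_seq_cond big1 // => j /andP[jin sj].
(* Either [P] has all its deg P nonzero roots in [K], or the norm of [P ^+ j] is 0 and [phi]
   vanishes there. *)
have := D0 j jin; rewrite sj /D /nz_indicator /= mulf_eq0.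
case/orP => [/eqP->|]; first by rewrite mul0r.
by rewrite pnatr_eq0 eqb0 negbK => /eqP->; rewrite phi0 mulr0.
Qed.

Lemma sum_gal_formula phi : (forall u, phi u 0 = 0) ->
  \sum_(y : L | (y \in K) && (y != 0)) phi (tr y) (nm y) =
  (#|F|%:R ^+ t - 1) / (#|F|%:R * (#|F|%:R - 1)) * mass phi
  + (-1) ^+ t.-1 * (iter t (@conv F) phi 0 1
       - (#|F|%:R - 1) ^+ t / (#|F|%:R * (#|F|%:R - 1)) * mass phi).
Proof.
move=> phi0; rewrite sum_gal_mangoldt // mangoldt_sum_formula //.
by rewrite dim_subfield_gt0 leqnn.
Qed.

End FieldCount.

(** * Trace and norm from the top field on elements of a subfield *)

Section FieldTower.
Variables (F : finFieldType) (E : fieldExtType F).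
Local Notation L := (finvect_type E).
Variable K : {subfield L}.

Lemma galTrace_to_base (y : L) : y \in K ->
  galTrace 1 K y = (to_base (galTrace 1 K y))%:A.
Proof.
move=> Ky; have [P [j [_ _ _ _ yP]]] := gal_poly_irred_pow Ky.
by rewrite -gal_poly_tr yP poly_tr_map /= to_baseK.
Qed.

Lemma galNorm_to_base (y : L) : y \in K ->
  galNorm 1 K y = (to_base (galNorm 1 K y))%:A.
Proof.
move=> Ky; have [P [j [_ _ _ _ yP]]] := gal_poly_irred_pow Ky.
by rewrite -gal_poly_nm yP poly_nm_map /= to_baseK.
Qed.

(** Both sides are powers of the same minimal polynomial of [y], so comparing degrees suffices. *)
Lemma gal_poly_tower (y : L) : y \in K -> (\dim K %| \dim {:L})%N ->
  gal_poly {:L}%AS y = gal_poly K y ^+ (\dim {:L} %/ \dim K).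
Proof.
move=> Ky tm.
have [P [j [Pm Pi Py PR yP]]] := gal_poly_irred_pow Ky.
have [P' [j' [P'm P'i P'y P'R yP']]] := gal_poly_irred_pow (memvf y).
have PP : P' = P by apply: dvdp_irred_eq => //; apply: P'R.
rewrite {P'm P'i P'y P'R}PP in yP'.
rewrite yP yP' -rmorphXn -exprM; congr (map_poly _ (_ ^+ _)).
have P1 : (0 < (size P).-1)%N by case: (size P) Pi.1 => [|[]].
have sj : ((size P).-1 * j)%N = \dim K.
  by rewrite -size_exp -(size_map_poly (GRing.in_alg L)) -yP size_gal_poly.
have sj' : ((size P).-1 * j')%N = \dim {:L}.
  by rewrite -size_exp -(size_map_poly (GRing.in_alg L)) -yP' size_gal_poly.
apply/eqP; rewrite -(eqn_pmul2l P1) mulnA sj sj'.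
by rewrite mulnC divnK.
Qed.

Lemma gal_poly_monic (K' : {subfield L}) (y : L) : gal_poly K' y \is monic.
Proof. exact: monic_prod_XsubC. Qed.

Lemma galTrace_tower (y : L) : y \in K -> (\dim K %| \dim {:L})%N ->
  galTrace 1 {:L}%AS y = galTrace 1 K y *+ (\dim {:L} %/ \dim K).
Proof.
by move=> Ky tm; rewrite -!gal_poly_tr gal_poly_tower // poly_trX ?gal_poly_monic.
Qed.

Lemma galNorm_tower (y : L) : y \in K -> (\dim K %| \dim {:L})%N ->
  galNorm 1 {:L}%AS y = galNorm 1 K y ^+ (\dim {:L} %/ \dim K).
Proof.
by move=> Ky tm; rewrite -!gal_poly_nm gal_poly_tower // poly_nmX ?gal_poly_monic.
Qed.

End FieldTower.

(** * Iterated convolution as a sum over tuples with given sum and product *)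

Section ConvIter.
Variable F : finFieldType.
Implicit Types phi psi : F -> F -> rat.

Lemma iter_conv_ext n phi psi : phi =2 psi ->
  iter n (@conv F) phi =2 iter n (@conv F) psi.
Proof. by move=> E; elim: n => [|n IH] //=; apply: conv_ext. Qed.

Lemma big_ffun_ordS n (G : F -> F -> rat) :
  \sum_(x : {ffun 'I_n.+1 -> F}) G (\sum_i x i) (\prod_i x i) =
  \sum_c \sum_(x : {ffun 'I_n -> F}) G (c + \sum_i x i) (c * \prod_i x i).
Proof.
rewrite pair_big /=.
pose h (z : F * {ffun 'I_n -> F}) : {ffun 'I_n.+1 -> F} :=
  [ffun i => if unlift ord0 i is Some j then z.2 j else z.1].
pose h' (x : {ffun 'I_n.+1 -> F}) := (x ord0, [ffun j : 'I_n => x (lift ord0 j)]).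
rewrite (reindex h); last first.
  exists h' => [[c x]|x] _ /=.
    rewrite /h' /h ffunE unlift_none /=; congr (_, _); apply/ffunP => j.
    by rewrite !ffunE liftK.
  by apply/ffunP => i; rewrite ffunE; case: unliftP => [j|] -> //=; rewrite ffunE.
apply: eq_bigr => -[c x] _ /=; rewrite !big_ord_recl !ffunE unlift_none /=.
by congr (G (c + _) (c * _)); apply: eq_bigr => i _; rewrite ffunE liftK.
Qed.

Lemma iter_convE n phi u v :
  iter n (@conv F) phi u v =
  \sum_(x : {ffun 'I_n -> F}) phi (u + \sum_i x i) (v * \prod_i x i).
Proof.
elim: n u v => [|n IH] u v.
  rewrite (eq_bigr (fun=> phi u v)) => [|x _]; last by rewrite !big_ord0 addr0 mulr1.
  by rewrite sumr_const card_ffun card_ord expn0.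
rewrite iterS /conv (big_ffun_ordS n (fun s p => phi (u + s) (v * p))).
apply: eq_bigr => c _; rewrite IH; apply: eq_bigr => x _.
by rewrite addrA mulrA.
Qed.

(** The substitution [x = a y] normalizes the sum to 1 and divides the product by [a ^+ n]. *)
Lemma card_sum_prod_scale n (a w : F) : a != 0 ->
  \sum_(x : {ffun 'I_n -> F}) ((\sum_i x i == a) && (\prod_i x i == w))%:R
    = (card_sum_prod n (w * a ^- n))%:R :> rat.
Proof.
move=> a0; rewrite /card_sum_prod -sum1_card natr_sum [RHS]big_mkcond /=.
pose s (b : F) (x : {ffun 'I_n -> F}) := [ffun i => b * x i].
have sK : {in xpredT, cancel (s a) (s a^-1)}.
  by move=> x _; apply/ffunP => i; rewrite !ffunE mulKf.
have sK' : {in xpredT, cancel (s a^-1) (s a)}.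
  by move=> x _; apply/ffunP => i; rewrite !ffunE mulVKf.
rewrite (reindex (s a)); last by exists (s a^-1) => x _; [apply: sK|apply: sK'].
apply: eq_bigr => x _; rewrite inE.
under eq_bigr do rewrite ffunE.
under [\prod_i s a x i]eq_bigr do rewrite ffunE.
rewrite -mulr_sumr big_split /= prodr_const card_ord.
rewrite -{2}[a]mulr1 (inj_eq (mulfI a0)).
have an : a ^+ n != 0 by rewrite expf_neq0.
rewrite -(inj_eq (mulfI an) _ (w * _)) mulrC [_ * (w * _)]mulrCA divff // mulr1.
by case: (_ && _).
Qed.

End ConvIter.

(** * Surjectivity of the norm *)

Section NormSurjective.
Variables (F : finFieldType) (E : fieldExtType F).
Local Notation L := (finvect_type E).
Variable K : {subfield L}.

(** The counting formula applied to the indicator of norm [c] gives [(q ^ t - 1) / (q - 1)], which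
    is nonzero: one convolution turns this indicator into the augmentation. *)
Lemma galNorm_surjective (c : F) : c != 0 ->
  exists2 y : L, (y \in K) && (y != 0) & galNorm 1 K y = c%:A.
Proof.
move=> c0; pose phi (u v : F) : rat := (v == c)%:R.
have phi0 u : phi u 0 = 0 by rewrite /phi eq_sym (negPf c0).
have cphi : conv phi =2 @nz_indicator F.
  move=> u v; rewrite /conv /phi /nz_indicator; have [->|v0] := eqVneq v 0.
    by rewrite big1 // => x _; rewrite mul0r eq_sym (negPf c0).
  rewrite (bigD1 (v^-1 * c)) //= mulVKf // eqxx big1 ?addr0 // => x xc.
  by rewrite -(inj_eq (mulfI v0) x) mulVKf // in xc; rewrite (negPf xc).
have mphi : mass phi = #|F|%:R.
  rewrite /mass (eq_bigr (fun=> 1)) => [|u _]; first by rewrite sumr_const.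
  by rewrite /phi (bigD1 c) //= eqxx big1 ?addr0 // => v /negPf->.
have := sum_gal_formula K phi0; rewrite mphi.
have := adim_gt0 K; have := card_neq0 F; have := card_neq1 F.
have q1 : (1 : rat) < #|F|%:R by rewrite ltr1n finNzRing_gt1.
case: (\dim K) => [|t] // q10 q0 _.
rewrite iterSr (iter_conv_ext _ cphi) iter_conv_nz_indicator /nz_indicator oner_neq0.
rewrite [X in _ = X](_ : _ = (#|F|%:R ^+ t.+1 - 1) / (#|F|%:R - 1)); last first.
  by rewrite /= !exprS; field; rewrite q0 q10.
move=> sumE.
case: (pickP (fun y : L => [&& y \in K, y != 0 & to_base (galNorm 1 K y) == c])).
  move=> y /and3P[Ky y0 /eqP yc]; exists y; first by rewrite Ky.
  by rewrite galNorm_to_base // yc.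
move=> none; have : (#|F|%:R ^+ t.+1 - 1) / (#|F|%:R - 1) != 0 :> rat.
  by rewrite mulf_neq0 ?invr_eq0 // subr_eq0 gt_eqF // exprn_egt1.
rewrite -sumE big1 ?eqxx // => y /andP[Ky y0].
by have := none y; rewrite Ky y0 /= /phi => ->.
Qed.

End NormSurjective.

(** * Generators of the multiplicative group and discrete logarithms *)

Section PrimitiveNorm.
Variable F : finFieldType.

(** The order [n] of [g] divides [q - 1], and the [q - 1] nonzero elements all lie among [n] powers
    of [g]. *)
Lemma generator_prim_root (g : F) : g != 0 ->
  (forall c : F, c != 0 -> exists k, c = g ^+ k) -> (#|F| - 1).-primitive_root g.
Proof.
move=> g0 gen; have F1 := finNzRing_gt1 F.
have n0 : (0 < #|F| - 1)%N by rewrite subn_gt0.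
have gn : g ^+ (#|F| - 1) = 1.
  by apply: (mulfI g0); rewrite -exprS subn1 prednK ?expf_card ?mulr1 // ltnW.
have [n prim ndvd] := prim_order_exists n0 gn.
suff -> : (#|F| - 1 = n)%N by [].
apply/eqP; rewrite eqn_leq (dvdn_leq n0 ndvd) andbT.
have := @uniq_leq_size _ (enum (predC1 (0 : F))) [seq g ^+ k | k <- iota 0 n].
rewrite enum_uniq -cardE cardC1 subn1 size_map size_iota; apply => // c.
rewrite mem_enum inE => /gen[k ->]; apply/mapP; exists (k %% n)%N.
  by rewrite mem_iota /= ltn_mod (prim_order_gt0 prim).
by rewrite (prim_expr_mod prim).
Qed.

Lemma discrete_logK (g b : F) : (#|F| - 1).-primitive_root g ->
  (exists k, b = g ^+ k) -> g ^+ discrete_log g b = b.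
Proof.
move=> prim [k bk]; rewrite /discrete_log; set s := map _ _.
have bs : b \in s.
  apply/mapP; exists (k %% (#|F| - 1))%N; last by rewrite (prim_expr_mod prim).
  by rewrite mem_iota /= -subn1 ltn_mod (prim_order_gt0 prim).
have lt : (index b s < #|F|.-1)%N.
  by rewrite -index_mem size_map size_iota in bs.
by rewrite -[RHS](nth_index 0 bs) (nth_map 0%N) ?size_iota // nth_iota.
Qed.

End PrimitiveNorm.

(** * Congruences and the solutions of a power equation *)

Lemma eqn_mod_intdvd (n x y : nat) :
  (x == y %[mod n])%N = (n%:Z %| x%:Z - y%:Z)%Z.
Proof. by rewrite -eqz_mod_dvd !modz_nat eqz_nat. Qed.

(** A residue class modulo [n] splits into the [d] distinct classes of [n * i + r] modulo [n * d],
    and [j] lies in exactly one of them. *)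
Lemma sum_residue_lifts (d n j r : nat) : (0 < d)%N -> (0 < n)%N ->
  (\sum_(0 <= i < d) (j == n * i + r %[mod n * d]) = (j == r %[mod n]))%N.
Proof.
move=> d0 n0; case: (boolP (j == r %[mod n])) => [jr|jr].
  (* Adding [n * d * r] keeps the residue of [j] modulo [n * d] and makes the difference with [r] a
     natural number; the matching index is [s %% d]. *)
  have [s sE] : exists s, (j + n * d * r = n * s + r)%N.
    have le : (r <= j + n * d * r)%N.
      by rewrite (leq_trans _ (leq_addl _ _)) // leq_pmull // muln_gt0 n0.
    have : (n %| j + n * d * r - r)%N.
      by rewrite -eqn_mod_dvd // -mulnA addnC mulnC modnMDl.
    by case/dvdnP => s sE; exists s; rewrite (mulnC n s) -sE subnK.
  rewrite big_nat (eq_bigr (fun i => if i == s %% d then 1 else 0)%N) => [|i].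
    by rewrite -big_nat -big_mkcond big_nat1_eq ltn_mod d0.
  rewrite /= => id; rewrite -(modnMDl r j) addnC (mulnC r) sE eqn_modDr.
  by rewrite -!muln_modr eqn_pmul2l // (modn_small id) eq_sym; case: ifP.
rewrite big1 // => i _; apply/eqP; rewrite eqb0; apply: contraNN jr.
move/eqP => E; apply/eqP.
have dv : (n %| n * d)%N by rewrite dvdn_mulr.
by rewrite -(modn_dvdm _ dv) E modn_dvdm // mulnC modnMDl.
Qed.

(** Write [v = g ^+ j] and let [d] be the gcd. Then [M * j] and [k] agree modulo [n] iff [j] and [r]
    agree modulo [n %/ d], because [M %/ d] is invertible there; that class has [d] lifts modulo
    [n]. For [v = 0] both sides vanish. *)
Lemma eq_expr_gcd_lifts (F : finFieldType) (n : nat) (g v : F) (M k r : nat) :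
  n.-primitive_root g -> (forall c : F, c != 0 -> exists j, c = g ^+ j) ->
  (0 < M)%N -> (gcdn n M %| k)%N ->
  (M %/ gcdn n M * r == k %/ gcdn n M %[mod n %/ gcdn n M])%N ->
  ((v ^+ M == g ^+ k) =
     \sum_(0 <= i < gcdn n M) (v == g ^+ (n %/ gcdn n M * i + r)) :> nat)%N.
Proof.
move=> prim gen M0; have n0 := prim_order_gt0 prim.
have g0 : g != 0 by rewrite (prim_root_eq0 prim) -lt0n.
have d0 : (0 < gcdn n M)%N by rewrite gcdn_gt0 n0.
have cop : coprime (n %/ gcdn n M) (M %/ gcdn n M).
  rewrite /coprime -(eqn_pmul2r d0) muln_gcdl mul1n.
  by rewrite !divnK ?dvdn_gcdl ?dvdn_gcdr.
have := divnK (dvdn_gcdl n M); have := divnK (dvdn_gcdr n M).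
have : (0 < n %/ gcdn n M)%N by rewrite divn_gt0 // dvdn_leq ?dvdn_gcdl.
move: cop d0; move: (gcdn n M) (n %/ _)%N (M %/ _)%N => d n' M' cop d0 n'0 ME nE.
case/dvdnP => e ->; rewrite mulnK // => re.
have [->|/gen[j ->]] := eqVneq v 0.
  rewrite expr0n (gtn_eqF M0) eq_sym expf_eq0 (negPf g0) andbF big1 // => i _.
  by rewrite eq_sym expf_eq0 (negPf g0) andbF.
rewrite (eq_bigr (fun i => nat_of_bool (j == n' * i + r %[mod n' * d]))); last first.
  by move=> i _; rewrite (eq_prim_root_expr prim) -nE.
rewrite sum_residue_lifts // -exprM (eq_prim_root_expr prim) -nE -ME.
rewrite mulnA -!muln_modl eqn_pmul2r //.
rewrite -(eqP re) [(M' * r)%N]mulnC !eqn_mod_intdvd !PoszM -mulrBl.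
by rewrite Gauss_dvdzl.
Qed.

Lemma exprz_modz (F : fieldType) (n : nat) (g : F) (i : int) : (0 < n)%N ->
  n.-primitive_root g -> g ^ i = g ^+ `|(i %% n)%Z|%N.
Proof.
move=> n0 prim.
have g0 : g != 0 by rewrite (prim_root_eq0 prim) -lt0n.
rewrite {1}(divz_eq i n) expfzDr // mulrC [((i %/ n)%Z * n)]mulrC -exprz_exp.
rewrite -exprnP (prim_expr_order prim) exp1rz mulr1 exprnP gez0_abs //.
by rewrite modz_ge0 // eqz_nat -lt0n.
Qed.

(** * Specialization of the counting formula to the prescribed trace and norm *)

Theorem theorem4p1 (p r m t : nat) (F : finFieldType) (E : fieldExtType F)
    (K : {subfield (finvect_type E)}) (a b : F) :
  let q := #|F| in
  prime p ->
  q = (p ^ r)%N ->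
  (2 <= m)%N ->
  \dim {: finvect_type E} = m ->
  a != 0 ->
  b != 0 ->
  (0 < t)%N ->
  (t %| m)%N ->
  ~~ (p %| m %/ t)%N ->
  \dim K = t ->
  forall (gamma : finvect_type E) (g : F),
  primitive_element K gamma ->
  galNorm 1%AS K gamma = g%:A ->
  let d := gcdn (q - 1) (m %/ t) in
  (d %| discrete_log g b)%N ->
  forall i0 : int,
  ((m %/ (d * t))%N%:Z * i0 = (discrete_log g b %/ d)%N%:Z
     %[mod ((q - 1) %/ d)%N%:Z])%Z ->
  (* t / m is the inverse of the integer m / t: p may divide both t and m,
     in which case m%:R = 0 in F *)
  let a0 : F := ((m %/ t)%:R)^-1 * a in
  let c (i : nat) : F :=
    g ^ (((q - 1) %/ d * i)%N%:Z + i0) * a0 ^- t in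
  (card_trace_norm K a b)%:R =
    d%:R * (q%:R ^+ t - 1) / (q%:R * (q%:R - 1))
    + (-1) ^+ (t - 1)
      * (\sum_(0 <= i < d) (card_sum_prod t (c i))%:R
         - d%:R * (q%:R - 1) ^+ t / (q%:R * (q%:R - 1))) :> rat.
Proof.
move=> q pp qE m2 mE a0 b0 t0 tm pmt tE gamma g [Kg gam0 gam_gen] gN.
set M := (m %/ t)%N in pmt *; move=> d dvd_ind i0 i0E a' c.
have F1 := finNzRing_gt1 F; rewrite -/q in F1.
have M0 : (0 < M)%N by rewrite divn_gt0 // dvdn_leq // ltnW.
have MF : M%:R != 0 :> F.
  have pF : p \in [pchar F] by apply: (card_finPcharP qE).
  by rewrite -(dvdn_pcharf pF).
have a'0 : a' != 0 by rewrite mulf_neq0 // invr_eq0.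
have g0 : g != 0.
  have : (g%:A : finvect_type E) != 0 by rewrite -gN galNorm_eq0.
  by apply: contraNneq => ->; rewrite scale0r.
(* A preimage of [x] under the norm is a power of [gamma], so [x] is the same power of [g]. *)
have gen (x : F) : x != 0 -> exists k, x = g ^+ k.
  case/(@galNorm_surjective F E K) => y /andP[Ky y0] yN.
  have [k yE] := gam_gen y Ky y0; exists k.
  apply: (fmorph_inj (GRing.in_alg (finvect_type E))).
  by rewrite /= -yN yE galNormX gN exprZn expr1n.
have prim := generator_prim_root g0 gen; rewrite -/q in prim.
have logb : g ^+ discrete_log g b = b by apply/discrete_logK/gen.
have n0 : (0 < q - 1)%N by rewrite subn_gt0.
have d0 : (0 < d)%N by rewrite gcdn_gt0 n0.
(* A natural representative of [i0] modulo [q - 1]: it leaves the power of [g] unchanged, and the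
   congruence survives because [(q - 1) %/ d] divides [q - 1]. *)
pose s := `|(i0 %% (q - 1)%N)%Z|%N.
have lifts v : ((v ^+ M == b) =
     \sum_(0 <= i < d) (v == g ^+ ((q - 1) %/ d * i + s)%N) :> nat)%N.
  rewrite -{1}logb; apply: eq_expr_gcd_lifts => //.
  rewrite -/d eqn_mod_intdvd.
  move/eqP: i0E; rewrite mulnC divnMA -/M eqz_mod_dvd => dvd_i0.
  rewrite PoszM gez0_abs; last by rewrite modz_ge0 // eqz_nat -lt0n.
  move: dvd_i0; rewrite {1}(divz_eq i0 (q - 1)%N) mulrDr -addrA rpredDl ?mulrA ?dvdz_mull //.
  suff nd : ((q - 1) %/ d %| q - 1)%N by exact: nd.
  by apply/dvdnP; exists d; rewrite mulnC divnK ?dvdn_gcdl.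
(* For [y] in [K] with trace [u] and norm [v] over [F], the trace and norm from the top field are
   [u *+ M] and [v ^+ M]. As [M] is invertible in [F], the conditions become those tested by
   [phi]. *)
pose phi (u v : F) : rat := ((u == a') && (v ^+ M == b))%:R.
have phiE u v : phi u v =
    \sum_(0 <= i < d) ((u == a') && (v == g ^+ ((q - 1) %/ d * i + s)%N))%:R.
  rewrite /phi; case: (u == a') => /=; first by rewrite lifts natr_sum.
  by rewrite big1.
have phi0 u : phi u 0 = 0.
  by rewrite /phi expr0n (gtn_eqF M0) (eq_sym _ b) (negPf b0) andbF.
(* One value of [u] and [d] values of [v] are allowed. *)
have mphi : mass phi = d%:R.
  rewrite /mass (bigD1 a') //= [X in _ + X]big1 ?addr0 => [|u ua]; last first.
    by rewrite big1 // => v _; rewrite /phi (negPf ua).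
  under eq_bigr do rewrite phiE.
  rewrite exchange_big (eq_bigr (fun=> 1)) => [|i _].
    by rewrite sumr_const_nat subn0.
  rewrite (bigD1 (g ^+ ((q - 1) %/ d * i + s)%N)) //= !eqxx big1 ?addr0 // => v.
  by move/negPf->; rewrite andbF.
have iphi : iter t (@conv F) phi 0 1 = \sum_(0 <= i < d) (card_sum_prod t (c i))%:R.
  rewrite iter_convE; under eq_bigr do rewrite phiE add0r mul1r.
  rewrite exchange_big; apply: eq_bigr => i _ /=.
  rewrite card_sum_prod_scale // /c expfzDr // (exprz_modz i0 n0 prim).
  by rewrite -exprnP -exprD.
have -> : (card_trace_norm K a b)%:R = \sum_(y : finvect_type E | (y \in K) && (y != 0))
   phi (to_base (galTrace 1 K y)) (to_base (galNorm 1 K y)).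
  rewrite /card_trace_norm -sum1_card natr_sum big_mkcond [RHS]big_mkcond /=.
  apply: eq_bigr => y _; rewrite inE; case: (boolP (y \in K)) => //= Ky.
  case: (y != 0) => //=.
  have tm' : (\dim K %| \dim {:finvect_type E})%N by rewrite mE tE.
  rewrite (galTrace_tower Ky tm') (galNorm_tower Ky tm') mE tE -/M.
  rewrite {1}(galTrace_to_base Ky) {1}(galNorm_to_base Ky) /phi.
  move: (to_base (galTrace 1 K y)) (to_base (galNorm 1 K y)) => u v.
  have -> : (u%:A *+ M == a%:A :> finvect_type E) = (u == a').
    rewrite scalerMnl (inj_eq (fmorph_inj (GRing.in_alg _))).
    by rewrite -(inj_eq (mulfI MF) u) mulVKf // mulr_natl.
  have -> : (v%:A ^+ M == b%:A :> finvect_type E) = (v ^+ M == b).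
    by rewrite exprZn expr1n (inj_eq (fmorph_inj (GRing.in_alg _))).
  by case: (_ && _).
rewrite sum_gal_formula // tE mphi iphi -/q subn1.
rewrite [_ * d%:R]mulrC mulrA; congr (_ + _ * (_ - _)).
by rewrite [_ * d%:R]mulrC mulrA.
Qed.
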